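(* Let $\mathcal{G}=(\mathcal{N},\mathcal{A})$ be a finite directed graph representing a wireline packet network, let $s\in\mathcal{N}$ be a source node, let $T\subset\mathcal{N}\setminus\{s\}$ be a non-empty set of sink nodes, and let $R>0$ be a real number. Let $Z\subset\mathbb{R}_{\ge 0}^{\mathcal{A}}$ be a convex set containing the origin (the constraint set), and let $z=(z_{ij})_{(i,j)\in\mathcal{A}}\in Z$ be a rate vector. For $i\in\mathcal{N}$, $t\in T$ put $\sigma_i^{(t)}=R$ if $i=s$, $\sigma_i^{(t)}=-R$ if $i=t$, and $\sigma_i^{(t)}=0$ otherwise. Let $f$ be a real-valued cost function on $Z$ and consider the optimization problem, in the variables $z$ and $x=(x_{ij}^{(t)})_{(i,j)\in\mathcal{A},\,t\in T}$, of minimizing $f(z)$ subject to $$z\in Z,\qquad z_{ij}\ge x_{ij}^{(t)}\ge 0\quad\forall (i,j)\in\mathcal{A},\ t\in T,$$ $$\sum_{\{j\mid (i,j)\in\mathcal{A}\}}x_{ij}^{(t)}-\sum_{\{j\mid (j,i)\in\mathcal{A}\}}x_{ji}^{(t)}=\sigma_i^{(t)}\quad\forall i\in\mathcal{N},\ t\in T.$$ Then $z$ is part of a feasible solution of this problem (i.e. there exists $x$ such that $(x,z)$ satisfies all the constraints) if and only if there exists a network code that sets up a multicast connection in the wireline network represented by $\mathcal{G}$ at rate arbitrarily close to $R$ from source $s$ to the sinks in $T$ and that injects packets at rate arbitrarily close to $z_{ij}$ on each arc $(i,j)\in\mathcal{A}$.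
   Context: Each arc $(i,j)\in\mathcal{A}$ is a lossless point-to-point link from node $i$ to node $j$. Rates are measured in packets per unit time, and $z_{ij}$ is the rate at which coded packets are injected into arc $(i,j)$. It is a standing assumption that rate vectors lie in $Z$. The network is a coded packet network: the contents of packets sent by a node may be arbitrary causal functions of the contents of packets it has received. Meaning of ''there exists a network code that sets up a multicast connection at rate arbitrarily close to $R$ from $s$ to $T$ and injects packets at rate arbitrarily close to $z_{ij}$ on each arc $(i,j)$'': for every $\varepsilon>0$ there exist a finite packet alphabet $Q$ with $|Q|\ge 2$, a block duration $\tau>0$, a non-negative integer $k$ with $|k/\tau-R|\le\varepsilon$, non-negative integers $N_{ij}$ with $|N_{ij}/\tau-z_{ij}|\le\varepsilon$ for each $(i,j)\in\mathcal{A}$, and a code of the following form. The message is an arbitrary element $w\in Q^k$ known only to $s$. The code is a finite sequence of transmissions, each being the transmission of one element of $Q$ (a packet) over one arc, with exactly $N_{ij}$ transmissions over arc $(i,j)$ in total. The packet sent by node $i$ in a given transmission is a fixed function of the packets received by $i$ in earlier transmissions (and also of $w$ if $i=s$). For each $t\in T$ there is a decoding function which, applied to all packets received by $t$, returns $w$, for every $w\in Q^k$. *)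

(* Defs.v *)
From HB Require Import structures.
From mathcomp Require Import all_boot all_order all_algebra.
From mathcomp Require Import boolp classical_sets interval_inference reals convex.

Set Implicit Arguments.
Unset Strict Implicit.
Unset Printing Implicit Defensive.

Import Order.TTheory GRing.Theory Num.Theory.
Local Open Scope ring_scope.

Section Wireline.

(* The directed graph has node set V and arc set A; loops are allowed. *)
Variables (V : finType) (A : {set V * V}).

Definition arcs := {a : V * V | a \in A}.
Definition arc_tail (a : arcs) : V := (val a).1.
Definition arc_head (a : arcs) : V := (val a).2.

Section Flow.

Variable R : realType.

(* R^o rather than R, so that vectors indexed by arcs form an R-module. *)
Definition arc_vector := {ffun arcs -> R^o}.

Definition supply (r : R) (s t i : V) : R :=
  if i == s then r else if i == t then - r else 0.

(* The components x t with t outside of T are unconstrained and play no role. *)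
Definition feasible (Z : set arc_vector) (s : V) (T : {set V}) (r : R)
    (z : arc_vector) (x : V -> arc_vector) : Prop :=
  [/\ Z z,
      forall t, t \in T -> forall a, 0 <= x t a <= z a
    & forall t, t \in T -> forall i,
        \sum_(a | arc_tail a == i) x t a - \sum_(a | arc_head a == i) x t a
          = supply r s t i].

End Flow.

Section Code.

Variables (Q : finType) (k : nat) (s : V).

(* The first argument of encode is the message if the tail of link is s, and
   None otherwise. The second is the list of the packets that the tail has
   received so far, in order of reception; as the sequence of links is fixed in
   advance, the position of a packet in this list determines which transmission
   it comes from. *)
Record transmission := Transmission {
  link : arcs;
  encode : option (k.-tuple Q) -> seq Q -> Q
}.

Definition code := seq transmission.

Definition known_message (w : k.-tuple Q) (i : V) : option (k.-tuple Q) :=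
  if i == s then Some w else None.

Definition received (h : seq (arcs * Q)) (i : V) : seq Q :=
  [seq p.2 | p <- h & arc_head p.1 == i].

Definition transmit (w : k.-tuple Q) (h : seq (arcs * Q)) (e : transmission) :
    seq (arcs * Q) :=
  let i := arc_tail (link e) in
  rcons h (link e, encode e (known_message w i) (received h i)).

(* The packets sent over the arcs, in order, when the message is w. *)
Definition history (c : code) (w : k.-tuple Q) : seq (arcs * Q) :=
  foldl (transmit w) [::] c.

Definition usage (c : code) (a : arcs) : nat := count_mem a (map link c).

Definition decodable (c : code) (t : V) : Prop :=
  exists dec : seq Q -> k.-tuple Q,
    forall w, dec (received (history c w) t) = w.

End Code.

Definition multicast_achievable (R : realType) (s : V) (T : {set V}) (r : R)
    (z : arc_vector R) : Prop :=
  forall eps : R, 0 < eps ->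
  exists (Q : finType) (tau : R) (k : nat) (n : arcs -> nat) (c : code Q k),
    [/\ (1 < #|Q|)%N /\ 0 < tau,
        `|k%:R / tau - r| <= eps,
        forall a, `|(n a)%:R / tau - z a| <= eps,
        forall a, usage c a = n a
      & forall t, t \in T -> decodable s c t].

End Wireline.

(* Main.v *)
(** Both sides are equivalent to the cut condition: every set of nodes that
    contains [s] but not some sink [t] has outgoing capacity at least [r].

    - Cuts to flows: lower the capacities one arc at a time, preserving the cut
      condition for [t], until every arc has capacity 0 or leaves a tight cut. By
      submodularity tight cuts are closed under intersection, and uncrossing
      shows that the remaining capacities are themselves a flow of value [r].
    - Codes to cuts: the packets crossing a cut determine everything received
      beyond it, hence the message, so a message has at most as many symbols as
      there are packets across the cut.
    - Cuts to codes: use each arc [a] about [n * z a] times in each of [N] rounds,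
      where [n] and [N] are large, and choose a linear code over ['F_p] packet by
      packet. For a nonzero message [w], call a node informed if it can tell [w]
      from 0. A random packet sent by an informed node fails to inform its
      receiver with probability [1 / p], and in each round all packets leaving
      the informed set must fail for the set not to grow. So the expected number
      of nonzero messages that miss some sink is at most
      [p ^ k * C * p ^ - (h * (N - #|V|))], where [h = floor (n * r)] and [C] does
      not depend on [p]. For [k = h * (N - #|V|) - 1] and large [p] this is less
      than 1. The choices are made greedily, by conditional expectations. *)

Require Import Defs.
From mathcomp Require Import all_boot all_order all_algebra.
From mathcomp Require Import boolp classical_sets interval_inference reals convex.
From mathcomp Require Import ring lra.

Set Implicit Arguments.
Unset Strict Implicit.
Unset Printing Implicit Defensive.

Import Order.TTheory GRing.Theory Num.Theory.
Local Open Scope ring_scope.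

(** * Maximum flow and minimum cut *)

Definition leaves (V E : finType) (tl hd : E -> V) (S : {set V}) (a : E) :=
  (tl a \in S) && (hd a \notin S).

Definition cut (R : realDomainType) (V E : finType) (tl hd : E -> V)
    (y : E -> R) (S : {set V}) : R := \sum_(a | leaves tl hd S a) y a.

Definition separates (V : finType) (s t : V) (S : {set V}) :=
  (s \in S) && (t \notin S).

Definition tight (R : realDomainType) (V E : finType) (tl hd : E -> V) (s t : V)
    (r : R) (y : E -> R) (S : {set V}) :=
  separates s t S && (cut tl hd y S == r).

Lemma cut_swap (R : realDomainType) (V E : finType) (tl hd : E -> V) (y : E -> R) S :
  cut hd tl y (~: S) = cut tl hd y S.
Proof. by apply: eq_bigl => a; rewrite /leaves !inE negbK andbC. Qed.

Lemma separates_swap (V : finType) (s t : V) S :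
  separates t s (~: S) = separates s t S.
Proof. by rewrite /separates !inE negbK andbC. Qed.

Section Flow.

Variables (R : realDomainType) (V E : finType) (tl hd : E -> V) (s t : V) (r : R).

Local Notation cut := (cut tl hd).
Local Notation leaves := (leaves tl hd).
Local Notation separates := (separates s t).
Local Notation tight := (tight tl hd s t r).

Lemma cutE (y : E -> R) S : cut y S = \sum_a (if leaves S a then y a else 0).
Proof. exact: big_mkcond. Qed.

(** The inequality holds arc by arc; an arc between the two differences of [S] and [S'] counts on
    the right only. *)
Lemma cut_submodular (y : E -> R) S S' : (forall a, 0 <= y a) ->
  cut y (S :&: S') + cut y (S :|: S') <= cut y S + cut y S'.
Proof.
move=> y0; rewrite !cutE -!big_split /=.
apply: ler_sum => a _; have := y0 a; rewrite /leaves !inE.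
by case: (tl a \in S); case: (tl a \in S'); case: (hd a \in S);
  case: (hd a \in S') => /=; lra.
Qed.

Lemma exists_tight_capacity (z : E -> R) : (forall a, 0 <= z a) ->
    (forall S, separates S -> r <= cut z S) ->
  exists y : E -> R,
    [/\ forall a, 0 <= y a <= z a, forall S, separates S -> r <= cut y S
      & forall a, y a != 0 -> exists2 S, tight y S & leaves S a].
Proof.
move=> z0 zr.
suff /(_ (enum E)) [y [yz yr yt]] : forall l : seq E, exists y : E -> R,
    [/\ forall a, 0 <= y a <= z a, forall S, separates S -> r <= cut y S
      & forall a, a \in l -> y a != 0 -> exists2 S, tight y S & leaves S a].
  by exists y; split=> // a; apply: yt; rewrite mem_enum.
elim=> [|a l [y [yz yr yt]]]; first by exists z; split=> // a; rewrite z0 lexx.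
have ya0 : 0 <= y a by case/andP: (yz a).
(* [d] is the largest admissible decrease of [y a]: it stops when [y a] reaches 0 or some cut that
   [a] leaves becomes tight. *)
have [d [d0 dy dcut dtight]] : exists d, [/\ 0 <= d, d <= y a,
    forall S, separates S -> leaves S a -> d <= cut y S - r
    & d = y a \/ exists2 S, separates S && leaves S a & d = cut y S - r].
  case: (pickP (fun S => separates S && leaves S a)) => [S0 PS0|noS].
    case: (@arg_minP _ _ _ S0 (fun S => separates S && leaves S a) (cut y) PS0).
    move=> S /andP [sS lS] Smin.
    exists (Num.min (y a) (cut y S - r)); split.
    - by rewrite le_min ya0 subr_ge0 yr.
    - by rewrite ge_min lexx.
    - move=> S' sS' lS'; rewrite ge_min lerD2r Smin ?orbT //; exact/andP.
    - by case: leP => _; [left | right; exists S => //; rewrite sS].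
  exists (y a); split=> //; last by left.
  by move=> S sS lS; have := noS S; rewrite sS lS.
pose y' b := if b == a then y b - d else y b.
have cut_y' S : cut y' S = cut y S - (if leaves S a then d else 0).
  rewrite /cut; case: ifP => lS; last first.
    rewrite subr0; apply: eq_bigr => b lb; rewrite /y'.
    by case: eqP => // eb; rewrite -eb lb in lS.
  rewrite (bigD1 a) //= [in RHS](bigD1 a) //= addrAC /y' eqxx; congr (_ + _).
  by apply: eq_bigr => b /andP [_ /negbTE ->].
have y'y b : y' b <= y b by rewrite /y'; case: eqP => // _; lra.
have y'r S : separates S -> r <= cut y' S.
  move=> sS; rewrite cut_y'; case: ifP => lS; last by rewrite subr0 yr.
  by have := dcut S sS lS; lra.
exists y'; split=> //.
  move=> b; have /andP [yb0 ybz] := yz b; rewrite (le_trans (y'y b)) // andbT /y'.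
  by case: eqP => [->|//]; rewrite subr_ge0.
move=> b; rewrite inE => /orP [/eqP ->|bl].
  rewrite /y' eqxx; case: dtight => [->|[S /andP [sS lS] dS]]; first by rewrite subrr eqxx.
  by move=> _; exists S => //; rewrite /tight sS cut_y' lS; apply/eqP; lra.
(* The tight cuts of the earlier arcs stay tight: their value cannot rise, and it is still at least
   [r]. *)
move=> y'b; have [|S /andP [sS /eqP Sr] lS] := yt b bl.
  by apply: contra y'b; rewrite /y'; case: (b =P a) => // -> /eqP ?; apply/eqP; lra.
exists S => //; rewrite /tight sS eq_le y'r //.
by rewrite -Sr cut_y' andbT; case: ifP => _; lra.
Qed.

(** * Capacities supported on arcs that leave tight cuts *)

Section Tight.

Variable y : E -> R.
Hypotheses (y0 : forall a, 0 <= y a) (yr : forall S, separates S -> r <= cut y S).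
Hypothesis yt : forall a, y a != 0 -> exists2 S, tight y S & leaves S a.

Lemma tight_setI S S' : tight y S -> tight y S' -> tight y (S :&: S').
Proof.
move=> /andP [/andP [sS tS] /eqP cS] /andP [/andP [sS' tS'] /eqP cS'].
have sI : separates (S :&: S') by rewrite /separates !inE sS sS' (negbTE tS).
have sU : separates (S :|: S') by rewrite /separates !inE sS (negbTE tS) (negbTE tS').
have := cut_submodular S S' y0; rewrite /tight sI eq_le yr // andbT cS cS'.
by have := yr sU; lra.
Qed.

(** Take [S] minimal among the tight sets that contain [v]. If an arc from [v] leaves a tight set
    [S'], then [S :&: S'] is tight and contains [v], so [S] lies in [S'] and misses the head of the
    arc. *)
Lemma tight_avoids_successors v :
    (exists2 a, tl a == v & y a != 0) ->
  exists2 S, tight y S & v \in S /\ forall a, tl a = v -> y a != 0 -> hd a \notin S.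
Proof.
case=> a0 /eqP tv ya0; have [S0 tS0 /andP [vS0 _]] := yt ya0.
have /ex_minset [S /minsetP [/andP [tS vS] Smin]] :
  exists S, (fun S => tight y S && (v \in S)) S by exists S0; rewrite tS0 -tv vS0.
exists S => //; split=> // a ta /yt [S' tS' /andP [vS' hS']].
have := Smin (S :&: S'); rewrite tight_setI // !inE vS -ta vS' subsetIl => /(_ isT isT) <-.
by rewrite inE (negbTE hS') andbF.
Qed.

(** With [S] as in the previous lemma, removing [v] from [S] takes the whole outflow of [v] off the
    cut and adds at most its inflow. The cut starts at [r] and cannot fall below it. *)
Lemma outflow_le_inflow v : v != s ->
  \sum_(a | tl a == v) y a <= \sum_(a | hd a == v) y a.
Proof.
move=> vs; case: (pickP (fun a => (tl a == v) && (y a != 0))) => [a /andP [ta ya]|none].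
  have [|S /andP [/andP [sS tS] /eqP cS] [vS out]] := @tight_avoids_successors v.
    by exists a.
  have sD : separates (S :\ v) by rewrite /separates !inE eq_sym vs sS (negbTE tS) andbF.
  suff : cut y (S :\ v) + \sum_(a | tl a == v) y a <= cut y S + \sum_(a | hd a == v) y a.
    by have := yr sD; rewrite cS; lra.
  rewrite !cutE [X in _ + X <= _]big_mkcond [X in _ <= _ + X]big_mkcond -!big_split /=.
  apply: ler_sum => b _.
  have := y0 b; rewrite le0r /leaves !inE => /orP [/eqP ->|yb].
    by do !case: ifP; rewrite ?addr0.
  case: eqP => [tb|_] /=.
    have hb := out b tb (lt0r_neq0 yb); have hv : hd b != v by apply: contraNneq hb => ->.
    by rewrite tb vS hb (negbTE hv) addrC.
  by case: (eqVneq (hd b) v) => [-> | _]; rewrite ?vS;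
    case: (tl b \in S) => //=; try case: (hd b \in S) => /=; lra.
rewrite big1 ?sumr_ge0 // => a ta.
by apply/eqP; have := none a; rewrite ta /= => /negbFE.
Qed.

Lemma source_inflow0 : \sum_(a | hd a == s) y a = 0.
Proof.
apply: big1 => a /eqP ha; apply/eqP/negPn/negP => /yt [S /andP [/andP [sS _] _]].
by rewrite /leaves ha sS andbF.
Qed.

(** The cut around [s] alone gives one inequality; for the other, all the outflow of [s] crosses a
    single tight cut. *)
Lemma source_outflow : 0 <= r -> s != t -> \sum_(a | tl a == s) y a = r.
Proof.
move=> r0 st; apply/eqP; rewrite eq_le; apply/andP; split; last first.
  apply: le_trans (yr (S := [set s]) _) _; first by rewrite /separates !inE eqxx eq_sym st.
  rewrite /cut big_mkcond [leRHS]big_mkcond ler_sum // => a _; rewrite /leaves !inE.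
  by case: eqP => //= _; case: ifP.
case: (pickP (fun a => (tl a == s) && (y a != 0))) => [a /andP [ta ya]|none].
  have [|S /andP [_ /eqP <-] [vS out]] := @tight_avoids_successors s; first by exists a.
  rewrite cutE big_mkcond ler_sum // => b _; rewrite /leaves; case: eqP => [tb|_].
    case: (eqVneq (y b) 0) => [-> | yb]; first by case: ifP.
    by rewrite tb vS out.
  by case: ifP.
rewrite big1 // => a ta.
by apply/eqP; have := none a; rewrite ta /= => /negbFE.
Qed.

End Tight.
End Flow.

Lemma max_flow_min_cut (R : realDomainType) (V E : finType) (tl hd : E -> V)
    (s t : V) (r : R) (z : E -> R) : 0 <= r -> s != t -> (forall a, 0 <= z a) ->
    (forall S, separates s t S -> r <= cut tl hd z S) ->
  exists y : E -> R, (forall a, 0 <= y a <= z a) /\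
    forall v, \sum_(a | tl a == v) y a - \sum_(a | hd a == v) y a
      = if v == s then r else if v == t then - r else 0.
Proof.
move=> r0 st z0 zr; have [y [yz yr yt]] := exists_tight_capacity z0 zr.
have y0 a : 0 <= y a by case/andP: (yz a).
exists y; split=> // v.
(* The hypotheses are invariant under reversing the arcs and exchanging [s] and
   [t], which turns bounds on outflows into bounds on inflows. *)
have yr' S : separates t s S -> r <= cut hd tl y S.
  by rewrite -[S]finset.setCK separates_swap cut_swap; apply: yr.
have yt' a : y a != 0 -> exists2 S, tight hd tl t s r y S & leaves hd tl S a.
  move=> /yt [S tS lS]; exists (~: S); last by rewrite /leaves !inE negbK andbC.
  by rewrite /tight separates_swap cut_swap.
case: (eqVneq v s) => [->|vs].
  by rewrite (source_outflow y0 yr yt r0 st) (source_inflow0 yt) subr0.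
case: (eqVneq v t) => [->|vt].
  by rewrite (source_outflow y0 yr' yt' r0) 1?eq_sym // (source_inflow0 yt') sub0r.
apply/eqP; rewrite subr_eq0 eq_le (outflow_le_inflow y0 yr yt vs).
exact: (outflow_le_inflow y0 yr' yt' vt).
Qed.

(** Summing conservation over [S], where only [s] has a nonzero supply, gives [r] as the net flow
    out of [S]. *)
Lemma flow_le_cut (R : realDomainType) (V E : finType) (tl hd : E -> V)
    (s t : V) (r : R) (x z : E -> R) S : separates s t S ->
    (forall a, 0 <= x a <= z a) ->
    (forall v, \sum_(a | tl a == v) x a - \sum_(a | hd a == v) x a
      = if v == s then r else if v == t then - r else 0) ->
  r <= cut tl hd z S.
Proof.
move=> /andP [sS tS] xz xr.
have <- : \sum_(v in S) (if v == s then r else if v == t then - r else 0) = r.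
  rewrite (bigD1 s) //= eqxx big1 ?addr0 // => v /andP [vS /negbTE ->].
  by case: eqP => // vt; rewrite -vt vS in tS.
under eq_bigr => v _ do rewrite -xr.
have fib (f : E -> V) : \sum_(v in S) \sum_(a | f a == v) x a = \sum_(a | f a \in S) x a.
  rewrite (partition_big f (mem S)) //=; apply: eq_bigr => v vS; apply: eq_bigl => a.
  by case: eqP => [->|]; rewrite ?vS ?andbF.
rewrite sumrB !fib cutE lerBlDr [X in _ <= _ + X]big_mkcond [leLHS]big_mkcond.
rewrite -big_split /=; apply: ler_sum => a _; have := xz a; rewrite /leaves.
by case: (tl a \in S); case: (hd a \in S) => /=; lra.
Qed.

(** * Codes obey the cut condition *)

Lemma count_sum_count_mem (I : finType) (P : pred I) (l : seq I) :
  count P l = (\sum_(a | P a) count_mem a l)%N.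
Proof.
elim: l => [|b l IH]; first by rewrite big1.
rewrite /= IH big_split; congr (_ + _)%N; rewrite big_mkcond (bigD1 b) //= eqxx.
by rewrite big1 ?addn0 => [|a /negbTE]; [case: (P b) | rewrite eq_sym => ->; case: (P a)].
Qed.

Section CutBound.

Variables (V : finType) (A : {set V * V}) (Q : finType) (k : nat) (s : V).

Local Notation leaves := (leaves (@arc_tail V A) (@arc_head V A)).

Lemma history_rcons (c : code A Q k) e w :
  history s (rcons c e) w = transmit s w (history s c w) e.
Proof. by rewrite /history foldl_rcons. Qed.

Lemma links_history (c : code A Q k) w :
  [seq p.1 | p <- history s c w] = [seq link e | e <- c].
Proof.
by elim/last_ind: c => [|c e IH] //; rewrite history_rcons /transmit !map_rcons IH.
Qed.

(** By induction on the code: a packet received outside [S] either crosses the cut or is sent by a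
    node outside [S], which does not know the message and has received the same packets for [w] and
    [w']. *)
Lemma history_outside_cut (c : code A Q k) (S : {set V}) w w' : s \in S ->
    [seq p <- history s c w | leaves S p.1] = [seq p <- history s c w' | leaves S p.1] ->
  [seq p <- history s c w | arc_head p.1 \notin S]
    = [seq p <- history s c w' | arc_head p.1 \notin S].
Proof.
move=> sS; elim/last_ind: c => [|c e IH] //; rewrite !history_rcons /transmit.
rewrite !filter_rcons /=; case: (boolP (leaves S _)) => [/andP [tS hS]|].
  by move=> /rcons_inj [/IH IH' ->]; rewrite hS IH'.
rewrite negb_and negbK => nl /IH IH'; case: ifP => // hS.
rewrite (negbTE hS) orbF in nl; rewrite IH'; congr (rcons _ (_, encode _ _ _)).
  by rewrite /known_message; case: eqP nl => // ->; rewrite sS.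
have recv h : received h (arc_tail (link e)) =
    received [seq p <- h | arc_head p.1 \notin S] (arc_tail (link e)).
  rewrite /received -filter_predI; congr map; apply: eq_filter => p /=.
  by case: eqP => // ->; rewrite nl.
by rewrite recv IH' -recv.
Qed.

Lemma message_length_le_cut (c : code A Q k) (S : {set V}) t : (1 < #|Q|)%N ->
    separates s t S -> decodable s c t ->
  (k <= \sum_(a | leaves S a) usage c a)%N.
Proof.
move=> Q1 /andP [sS tS] [dec decK].
have sz w : size [seq p <- history s c w | leaves S p.1]
    == (\sum_(a | leaves S a) usage c a)%N.
  rewrite size_filter -count_sum_count_mem -(links_history c w) count_map.
  exact/eqP/eq_count.
pose F w : (\sum_(a | leaves S a) usage c a).-tuple (arcs A * Q) := Tuple (sz w).
(* Forgetting the arcs leaves words over [Q] alone. Nothing is lost, since the arcs are the same for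
   all messages. *)
pose G w := map_tuple snd (F w).
suff : injective G by move=> /leq_card; rewrite !card_tuple leq_exp2l.
move=> w w' /(congr1 val) /= eG.
have eF : [seq p <- history s c w | leaves S p.1] = [seq p <- history s c w' | leaves S p.1].
  have fstE u : unzip1 [seq p <- history s c u | leaves S p.1]
      = [seq a <- [seq link e | e <- c] | leaves S a].
    by rewrite -(links_history c u) filter_map.
  by rewrite -(zip_unzip [seq p <- history s c w | _]) fstE -(fstE w') /unzip2 eG zip_unzip.
have eo := history_outside_cut sS eF.
rewrite -(decK w) -(decK w') /received; congr dec.
have fil h : [seq p <- h | arc_head p.1 == t] =
    [seq p <- [seq p : arcs A * Q <- h | arc_head p.1 \notin S] | arc_head p.1 == t].
  by rewrite -filter_predI; apply: eq_filter => p /=; case: eqP => // ->; rewrite tS.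
by rewrite fil [in RHS]fil eo.
Qed.

End CutBound.

Lemma achievable_le_cut (R : realType) (V : finType) (A : {set V * V}) (s t : V)
    (T : {set V}) (r : R) (z : arc_vector A R) S :
    multicast_achievable s T r z -> t \in T -> separates s t S ->
  r <= cut (@arc_tail V A) (@arc_head V A) z S.
Proof.
move=> ach tT sS; apply/ler_addgt0Pr => e e0.
pose m := #|[pred a | leaves (@arc_tail V A) (@arc_head V A) S a]|.
(* The error [e] is shared equally between the [m] arcs of the cut and the message rate. *)
have [d d0 dE] : exists2 d, 0 < d & d *+ m + d = e.
  exists (e / m.+1%:R); first by rewrite divr_gt0 ?ltr0Sn.
  by rewrite -mulrSr -[LHS]mulr_natr divfK // pnatr_eq0.
have [Q [tau [k [n [c [[Q1 tau0] hk hn un dc]]]]]] := ach d d0.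
have := message_length_le_cut Q1 sS (dc t tT).
under eq_bigr => a _ do rewrite un.
rewrite -(ler_nat R) natr_sum -(ler_pM2r (_ : 0 < tau^-1)) ?invr_gt0 // mulr_suml => kn.
have {hk} : r <= k%:R / tau + d.
  by move: hk; rewrite ler_norml; set u := _ / _ => /andP [? _]; lra.
move=> /le_trans; apply; rewrite -dE addrA lerD2r; apply: le_trans kn _.
rewrite /m -sumr_const /cut -big_split; apply: ler_sum => a _.
by move: (hn a); rewrite ler_norml => /andP [_]; rewrite lerBlDl.
Qed.

(** * Linear codes over a fixed schedule of transmissions *)

Section Weight.

Variables (V E : finType) (tl hd : E -> V) (T : {set V}) (K : realFieldType) (q : K).
Hypothesis q1 : 1 <= q.

Local Notation leaves := (leaves tl hd).

(* An upper bound for the probability that some sink stays uninformed when the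
   nodes of [S] are informed and the transmissions [l] remain; the success
   probability [1 - 1 / q] of a packet is replaced by 1. *)
Fixpoint weight (l : seq E) (S : {set V}) : K :=
  if l is a :: l' then
    if leaves S a then weight l' S / q + weight l' (hd a |: S) else weight l' S
  else (~~ (T \subset S))%:R.

Let q0 : 0 < q. Proof. exact: lt_le_trans q1. Qed.

Lemma weight_ge0 l S : 0 <= weight l S.
Proof.
elim: l S => [|a l IH] S /=; first exact: ler0n.
by case: ifP => // _; rewrite addr_ge0 ?divr_ge0 // ltW.
Qed.

Lemma weight_informed l (S : {set V}) : T \subset S -> weight l S = 0.
Proof.
elim: l S => [|a l IH] S TS /=; first by rewrite TS.
by rewrite !IH ?mul0r ?addr0 ?if_same // (fintype.subset_trans TS) ?finset.subsetUr.
Qed.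

Lemma divq_le x : 0 <= x -> x / q <= x.
Proof. by move=> x0; rewrite ler_pdivrMr // ler_peMr. Qed.

(** Each transmission of [l1] replaces the weight by at most two terms with factors at most 1, on
    sets that still contain [S]. *)
Lemma weight_cat_le l1 l2 (S : {set V}) B : 0 <= B ->
    (forall S' : {set V}, S \subset S' -> weight l2 S' <= B) ->
  weight (l1 ++ l2) S <= 2 ^+ size l1 * B.
Proof.
move=> B0; elim: l1 S => [|a l1 IH] S WB /=; first by rewrite mul1r WB.
have WS : weight (l1 ++ l2) S <= 2 ^+ size l1 * B by apply: IH.
have X0 : 0 <= 2 ^+ size l1 * B by rewrite mulr_ge0 ?exprn_ge0.
rewrite exprS -mulrA; case: ifP => _; last by lra.
have WS' : weight (l1 ++ l2) (hd a |: S) <= 2 ^+ size l1 * B.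
  by apply: IH => S' SS'; apply: WB; apply: fintype.subset_trans SS'; apply: finset.subsetUr.
have := divq_le (weight_ge0 (l1 ++ l2) S); lra.
Qed.

(* During [l1] either every packet that leaves [S] fails, each at the price of a
   factor [1 / q], or the informed set becomes strictly larger than [S]. *)
Lemma weight_cat_le_proper l1 l2 (S : {set V}) B : 0 <= B ->
    (forall S' : {set V}, S \proper S' -> weight l2 S' <= B) ->
  weight (l1 ++ l2) S <= weight l2 S / q ^+ count (leaves S) l1 + 2 ^+ size l1 * B.
Proof.
move=> B0 WB; elim: l1 => [|a l1 IH] /=; first by rewrite divr1 mul1r; lra.
have X0 : 0 <= 2 ^+ size l1 * B by rewrite mulr_ge0 ?exprn_ge0.
rewrite [2 ^+ _.+1]exprS -mulrA; case: ifP => [la|_]; last by rewrite add0n; lra.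
have WS' : weight (l1 ++ l2) (hd a |: S) <= 2 ^+ size l1 * B.
  apply: weight_cat_le => // S' SS'; apply: WB; apply: proper_sub_trans SS'.
  by rewrite properUr // finset.sub1set; case/andP: la.
rewrite add1n [q ^+ _.+1]exprSr invfM mulrA.
have : weight (l1 ++ l2) S / q
    <= weight l2 S / q ^+ count (leaves S) l1 / q + 2 ^+ size l1 * B / q.
  by rewrite -mulrDl ler_pM2r ?invr_gt0.
by have := divq_le X0; lra.
Qed.

Lemma weight_rounds (s : V) l h n (S : {set V}) :
    (forall S : {set V}, s \in S -> ~~ (T \subset S) -> (h <= count (leaves S) l)%N) ->
    s \in S ->
  weight (flatten (nseq n l)) S * q ^+ (h * n)
    <= (2 ^+ size l + 1) ^+ n * q ^+ (h * #|~: S|).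
Proof.
move=> cuth; elim: n S => [|n IH] S sS.
  rewrite muln0 expr0 mulr1 mul1r /=; apply: le_trans (exprn_ege1 _ q1).
  by case: (~~ _); rewrite ?ler01.
have k0 : 0 <= (2 ^+ size l + 1 : K) by rewrite addr_ge0 ?exprn_ge0.
case: (boolP (T \subset S)) => TS.
  by rewrite weight_informed // mul0r mulr_ge0 ?exprn_ge0 ?(ltW q0).
have [d dE] : exists d, #|~: S| = d.+1.
  case: #|~: S| (cards_eq0 (~: S)) => [|d _]; last by exists d.
  rewrite eqxx => /esym/eqP S0; case/negP: TS.
  by rewrite -(finset.setCK S) S0 finset.setC0 finset.subsetT.
have X0 : 0 < q ^+ (h * n) by rewrite exprn_gt0.
(* [B] is the induction hypothesis for proper supersets of [S], whose complements have at most [d]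
   elements. *)
pose B := (2 ^+ size l + 1) ^+ n * q ^+ (h * d) / q ^+ (h * n).
have B0 : 0 <= B by rewrite divr_ge0 ?mulr_ge0 ?exprn_ge0 // ltW.
have WB (S' : {set V}) : S \proper S' -> weight (flatten (nseq n l)) S' <= B.
  move=> SS'; rewrite ler_pdivlMr //; apply: le_trans (IH S' _) _.
    exact: (fintype.subsetP (proper_sub SS')).
  rewrite ler_wpM2l ?exprn_ge0 // ler_weXn2l // leq_mul2l; apply/orP; right.
  by rewrite -ltnS -dE; apply: proper_card; rewrite properC.
have {}IH := IH S sS; rewrite dE mulnS exprD in IH.
rewrite dE !mulnS !exprD /=.
apply: le_trans (ler_wpM2r _ (weight_cat_le_proper l B0 WB)) _.
  by rewrite mulr_ge0 ?exprn_ge0 // ltW.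
have XV : q ^+ (h * n) != 0 by rewrite gt_eqF.
(* The summand 1 pays for a round without growth, [2 ^+ size l] for a round in which the informed
   set grows. *)
have -> : (2 ^+ size l + 1) ^+ n.+1 * (q ^+ h * q ^+ (h * d))
    = (2 ^+ size l + 1) ^+ n * (q ^+ h * q ^+ (h * d))
      + 2 ^+ size l * B * (q ^+ h * q ^+ (h * n)).
  by rewrite exprSr /B; field.
have YC : q ^+ h / q ^+ count (leaves S) l <= 1.
  by rewrite ler_pdivrMr ?exprn_gt0 // mul1r ler_weXn2l // cuth.
rewrite [leLHS]mulrDl lerD2r [q ^+ h * q ^+ (h * n)]mulrC mulrACA [_^-1 * _]mulrC.
by apply: le_trans IH; rewrite ler_piMr // mulr_ge0 ?weight_ge0 // ltW.
Qed.

End Weight.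

(** If [v i] is nonzero, the translates of the hyperplane by multiples of the [i]-th unit vector are
    disjoint. *)
Lemma card_hyperplane_le (F : finFieldType) m (v : 'cV[F]_m) : v != 0 ->
  (#|[set c : 'rV[F]_m | ((c *m v) 0 0 == 0)%R]| * #|F| <= #|{: 'rV[F]_m}|)%N.
Proof.
case/cV0Pn => i vi.
rewrite -cardsT -cardsX -cardsT.
pose f (cx : 'rV[F]_m * F) := cx.1 + cx.2 *: delta_mx 0 i.
rewrite -(card_in_imset (f := f)); first exact/subset_leq_card/finset.subsetT.
have fv c x : (c *m v) 0 0 == 0 -> (f (c, x) *m v) 0 0 = x * v i 0.
  by move=> /eqP c0; rewrite /f /= mulmxDl -scalemxAl -rowE mxE c0 add0r !mxE.
move=> [c x] [c' x'] /setXP [/=]; rewrite inE => c0 _ /setXP [/=]; rewrite inE => c'0 _ e.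
have xx : x = x' by apply: (mulIf vi); rewrite -(fv c) // e fv.
by move: e; rewrite /f /= xx => /addIr ->.
Qed.

Lemma exists_le_average (K : realDomainType) (I : finType) (f : I -> K) B :
  (0 < #|I|)%N -> \sum_i f i <= #|I|%:R * B -> exists i, f i <= B.
Proof.
move=> /card_gt0P [i0 _] fB; case: (pickP (fun i => f i <= B)) => [i|nB]; first by exists i.
have : \sum_(i : I) B < \sum_i f i.
  apply: ltr_sum; first by apply/hasP; exists i0; rewrite ?mem_index_enum.
  by move=> i _; rewrite ltNge nB.
by rewrite sumr_const -mulr_natl ltNge fB.
Qed.

(** * Linear codes built packet by packet *)

Section Linear.

Variables (V : finType) (A : {set V * V}) (F : finFieldType) (k : nat) (s : V).

Local Notation packets := (seq (arcs A * 'rV[F]_k)).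

Definition pairing m (g : 'rV[F]_m) (w : 'cV[F]_m) : F := (g *m w) 0 0.

Definition evaluate (H : packets) (w : 'cV[F]_k) : seq (arcs A * F) :=
  [seq (p.1, pairing p.2 w) | p <- H].

Definition message (w : k.-tuple F) : 'cV[F]_k := \col_i tnth w i.

(* The packets of a linear code, as linear functionals of the message. *)
Definition realizable (H : packets) := exists c : code A F k,
  [seq link e | e <- c] = [seq p.1 | p <- H] /\
  forall w, history s c w = evaluate H (message w).

(* The nodes that can tell the message [w] from the message 0. *)
Definition informed (H : packets) (w : 'cV[F]_k) : {set V} :=
  [set i | (i == s) || has (fun g => pairing g w != 0) (received H i)].

Lemma received_evaluate H w i :
  received (evaluate H w) i = [seq pairing g w | g <- received H i].
Proof. by rewrite /received /evaluate filter_map -!map_comp. Qed.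

Lemma informed_rcons H a g w : informed (rcons H (a, g)) w =
  if pairing g w != 0 then arc_head a |: informed H w else informed H w.
Proof.
apply/setP => i; rewrite inE /received filter_rcons /=.
case: (eqVneq (arc_head a) i) => [-> | hi] /=.
  by rewrite map_rcons has_rcons /=; case: ifP => _; rewrite !inE ?eqxx ?orbT.
by case: ifP => _; rewrite !inE // [i == arc_head a]eq_sym (negbTE hi).
Qed.

(** The rows of [M] span the functionals available to the tail: all of them at [s], the received
    ones elsewhere. Nonzero [w] is required because [s] always counts as informed. *)
Lemma realizable_rcons H a : realizable H -> exists m (M : 'M[F]_(m, k)),
  (forall c : 'rV_m, realizable (rcons H (a, c *m M))) /\
  (forall w, w != 0 -> (arc_tail a \in informed H w) = (M *m w != 0)).
Proof.
case=> c [cl ch]; case: (eqVneq (arc_tail a) s) => [ta|ta].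
  exists k, 1%:M; split=> [g|w w0]; last by rewrite inE ta eqxx mul1mx w0.
  pose enc (o : option (k.-tuple F)) (_ : seq F) :=
    if o is Some w then pairing g (message w) else 0.
  exists (rcons c (Transmission a enc)); split=> [|w]; first by rewrite !map_rcons cl.
  by rewrite history_rcons /transmit /= ch /known_message ta eqxx /evaluate map_rcons mulmx1.
pose l := received H (arc_tail a).
pose M : 'M[F]_(size l, k) := \matrix_(j < size l) nth 0 l j.
have ME w j : (M *m w) j 0 = pairing (nth 0 l j) w.
  by rewrite /pairing -(rowK (fun j : 'I_(size l) => nth 0 l j)) -row_mul [RHS]mxE.
exists (size l), M; split=> [g|w w0].
  pose enc (_ : option (k.-tuple F)) (rs : seq F) := \sum_(j < size l) g 0 j * nth 0 rs j.
  exists (rcons c (Transmission a enc)); split=> [|w]; first by rewrite !map_rcons cl.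
  rewrite history_rcons /transmit /= ch /evaluate map_rcons /=; congr (rcons _ (_, _)).
  rewrite -/(evaluate H _) received_evaluate -/l {2}/pairing -mulmxA mxE.
  by apply: eq_bigr => j _; rewrite ME (nth_map 0).
rewrite inE (negbTE ta) /= -/l; apply/hasP/cV0Pn => [[g gl gw]|[j]].
  have jl : (index g l < size l)%N by rewrite index_mem.
  by exists (Ordinal jl); rewrite ME nth_index.
by rewrite ME => h; exists (nth 0 l j); rewrite ?mem_nth.
Qed.

Variables (T : {set V}) (K : realFieldType).

Local Notation weight := (weight (@arc_tail V A) (@arc_head V A) T (#|F|%:R : K)).

Let q1 : 1 <= (#|F|%:R : K).
Proof. by rewrite ler1n ltnW // card_finNzRing_gt1. Qed.

(** The bound holds on average over the coefficient rows [c], message by message, hence for some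
    [c]. *)
Lemma exists_good_packet H a l : realizable H -> exists g,
  realizable (rcons H (a, g)) /\
  \sum_(w | w != 0) weight l (informed (rcons H (a, g)) w)
    <= \sum_(w | w != 0) weight (a :: l) (informed H w).
Proof.
move=> /(realizable_rcons a) [m [M [real inf]]].
suff [c hc] : exists c : 'rV[F]_m,
    \sum_(w | w != 0) weight l (informed (rcons H (a, c *m M)) w)
    <= \sum_(w | w != 0) weight (a :: l) (informed H w) by exists (c *m M).
apply: exists_le_average; first by apply/card_gt0P; exists 0.
rewrite exchange_big mulr_sumr; apply: ler_sum => w w0; set S := informed H w.
have pM c : pairing (c *m M) w = pairing c (M *m w) by rewrite /pairing mulmxA.
under eq_bigr => c _ do rewrite informed_rcons pM -/S.
rewrite /= {1}/leaves inf //; case: (eqVneq (M *m w) 0) => [->|Mw] /=.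
  under eq_bigr => c _ do rewrite /pairing mulmx0 mxE eqxx /=.
  by rewrite sumr_const mulr_natl.
case: (boolP (arc_head a \in S)) => hS /=.
  have -> : arc_head a |: S = S by apply/finset.setUidPr; rewrite finset.sub1set.
  under eq_bigr => c _ do rewrite if_same.
  by rewrite sumr_const mulr_natl.
(* Rows whose packet vanishes at [w] are at most a fraction [1 / #|F|] of all rows; the share of the
   others is bounded by 1. *)
rewrite mulrDr (bigID (fun c => pairing c (M *m w) == 0)) /=; apply: lerD.
  under eq_bigr => c /= -> do rewrite /=.
  rewrite sumr_const -[leLHS]mulr_natl mulrA mulrAC ler_wpM2r ?weight_ge0 //.
  rewrite ler_pdivlMr; last exact: lt_le_trans q1.
  by rewrite -natrM ler_nat; have := card_hyperplane_le Mw; rewrite cardsE.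
under eq_bigr => c /= -> do rewrite /=.
by rewrite sumr_const -[leLHS]mulr_natl ler_wpM2r ?weight_ge0 // ler_nat max_card.
Qed.

Lemma exists_good_packets l H : realizable H -> exists H',
  [/\ realizable H', [seq p.1 | p <- H'] = [seq p.1 | p <- H] ++ l
    & \sum_(w | w != 0) weight [::] (informed H' w)
      <= \sum_(w | w != 0) weight l (informed H w)].
Proof.
elim: l H => [|a l IH] H rH; first by exists H; rewrite cats0.
have [g [rg hg]] := exists_good_packet a l rH; have [H' [rH' lH' hH']] := IH _ rg.
by exists H'; split=> //; [rewrite lH' map_rcons cat_rcons | apply: le_trans hg].
Qed.

(** By linearity, messages that look the same at [t] have a difference that [t] cannot tell from
    0. *)
Lemma decodable_informed (c : code A F k) H t : t != s ->
    (forall w, history s c w = evaluate H (message w)) ->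
    (forall w, w != 0 -> t \in informed H w) ->
  decodable s c t.
Proof.
move=> ts cH inf.
have inj w w' : received (history s c w) t = received (history s c w') t -> w = w'.
  rewrite !cH !received_evaluate => /eq_in_map e; apply/eqP/negPn/negP => ww.
  have /inf : message w - message w' != 0.
    apply: contra ww; rewrite subr_eq0 => /eqP /colP mm; apply/eqP/eq_from_tnth => i.
    by have := mm i; rewrite !mxE.
  rewrite inE (negbTE ts) /= => /hasP [g gH].
  have := e g gH; rewrite /pairing mulmxBr => eg.
  by rewrite !mxE; move: eg; rewrite !mxE => ->; rewrite subrr eqxx.
exists (fun rs => odflt [tuple of nseq k 0] [pick w | received (history s c w) t == rs]) => w.
by case: pickP => [w' /eqP /inj //|/(_ w)]; rewrite eqxx.
Qed.

(** Once the schedule is exhausted, the weights count the nonzero messages that miss a sink; a count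
    below 1 is 0. *)
Lemma exists_code l : s \notin T -> #|F|%:R ^+ k * weight l [set s] < 1 ->
  exists c : code A F k, [seq link e | e <- c] = l /\ forall t, t \in T -> decodable s c t.
Proof.
move=> sT small.
have r0 : realizable [::] by exists [::].
have [H [[c [cl cH]] Hl Hw]] := exists_good_packets l r0.
exists c; split=> [|t tT]; first by rewrite cl Hl.
apply: decodable_informed cH _ => [|w w0]; first by apply: contraNneq sT => <-.
have inf0 w' : informed [::] w' = [set s] by apply/setP => i; rewrite !inE orbF.
have : \sum_(w' | w' != 0) weight [::] (informed H w') < 1.
  apply: le_lt_trans small; apply: le_trans Hw _.
  under eq_bigr => w' _ do rewrite inf0.
  rewrite sumr_const -[leLHS]mulr_natl ler_wpM2r ?weight_ge0 // -natrX ler_nat.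
  by apply: leq_trans (max_card _) _; rewrite card_mx muln1.
apply: contraTT => tH; rewrite -leNgt (bigD1 w) //=.
have -> : T \subset informed H w = false.
  by apply: contraNF tH => /fintype.subsetP; apply.
by rewrite lerDl sumr_ge0 // => w' _; apply: ler0n.
Qed.

End Linear.

(** * From the cut condition to codes *)

Lemma count_mem_flatten_nseq (I : finType) (c : I -> nat) a :
  count_mem a (flatten [seq nseq (c b) b | b <- enum I]) = c a.
Proof.
rewrite count_flatten -map_comp sumnE big_map big_enum (bigD1 a) //= count_nseq /= eqxx mul1n.
by rewrite big1 ?addn0 // => b /negbTE ab; rewrite count_nseq /= ab.
Qed.

Lemma distr_div_le (R : realFieldType) (x y e tau : R) : 0 < tau ->
  (y - e) * tau <= x <= (y + e) * tau -> `|x / tau - y| <= e.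
Proof.
move=> tau0 /andP [h1 h2]; rewrite ler_norml; apply/andP; split.
  by rewrite lerBrDl ler_pdivlMr.
by rewrite lerBlDl ler_pdivrMr.
Qed.

Lemma exists_gt_nat (R : archiRealFieldType) (x : R) : exists n, x < n%:R.
Proof. by exists (Num.truncn x).+1; apply: truncnS_gt. Qed.

Lemma exists_linear_code (V : finType) (A : {set V * V}) (s : V) (T : {set V})
    (l : seq (arcs A)) h n : s \notin T -> (0 < h)%N -> (#|V| < n)%N ->
    (forall S : {set V}, s \in S -> ~~ (T \subset S) ->
       (h <= count (leaves (@arc_tail V A) (@arc_head V A) S) l)%N) ->
  exists (F : finFieldType) (c : code A F (h * (n - #|V|)).-1),
    [seq link e | e <- c] = flatten (nseq n l) /\ forall t, t \in T -> decodable s c t.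
Proof.
(* The prime must exceed the constant of [weight_rounds], which does not depend on the field. *)
move=> sT h0 nV hl; have [p big_p p_prime] := prime_above ((2 ^ size l + 1) ^ n).
exists 'F_p; apply: (exists_code (K := rat)) => //; rewrite card_Fp //.
have q1 : 1 <= p%:R :> rat by rewrite ler1n prime_gt0.
have q0 m : 0 < (p%:R : rat) ^+ m by rewrite exprn_gt0 // (lt_le_trans _ q1).
rewrite -(ltr_pM2r (q0 (h * n)%N)) mul1r -mulrA.
apply: le_lt_trans (ler_wpM2l (ltW (q0 _)) (weight_rounds q1 n hl (set11 s))) _.
(* The 1 taken off the message length leaves one spare factor [p] to beat that constant. *)
have -> : (h * n = (h * (n - #|V|)).-1 + 1 + h * #|V|)%N.
  by rewrite addn1 prednK ?muln_gt0 ?h0 ?subn_gt0 // -mulnDr subnK // ltnW.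
rewrite !exprD -mulrA ltr_pM2l // expr1.
have KE : (2 ^+ size l + 1) ^+ n = ((2 ^ size l + 1) ^ n)%:R :> rat.
  by rewrite natrX natrD natrX.
apply: (@le_lt_trans _ _ ((2 ^+ size l + 1) ^+ n * p%:R ^+ (h * #|V|))).
  by rewrite ler_wpM2l ?ler_weXn2l ?leq_mul2l ?max_card ?orbT.
by rewrite ltr_pM2r // KE ltr_nat.
Qed.

Lemma cut_achievable (R : realType) (V : finType) (A : {set V * V}) (s : V)
    (T : {set V}) (r : R) (z : arc_vector A R) : s \notin T -> 0 < r ->
    (forall a, 0 <= z a) ->
    (forall t S, t \in T -> separates s t S ->
       r <= cut (@arc_tail V A) (@arc_head V A) z S) ->
  multicast_achievable s T r z.
Proof.
move=> sT r0 z0 zr e e0.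
(* [n] makes the rounding errors of a round small against [e] and ensures [h > 0]; [m] makes the
   loss of [#|V|] rounds small. *)
have [n hn] := exists_gt_nat (4 / e + r^-1).
have [m hm] := exists_gt_nat (2 * r * #|V|%:R / e).
have n0 : 0 < n%:R :> R by apply: le_lt_trans hn; rewrite addr_ge0 ?divr_ge0 ?invr_ge0 // ltW.
have ne : 4 < n%:R * e.
  rewrite -ltr_pdivrMr //; apply: le_lt_trans hn; rewrite lerDl invr_ge0; exact: ltW.
have nr : 1 < n%:R * r.
  rewrite -ltr_pdivrMr // div1r; apply: le_lt_trans hn; rewrite lerDr divr_ge0 //; exact: ltW.
have m0 : (0 < m)%N.
  rewrite -(ltr_nat R); apply: le_lt_trans hm.
  by rewrite divr_ge0 ?mulr_ge0 // ltW.
move: hm; rewrite ltr_pdivrMr // => me.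
pose h := Num.truncn (n%:R * r).
have nr0 : 0 <= n%:R * r by lra.
have /andP [hle hgt] := truncn_itv nr0; rewrite -/h -natr1 in hle hgt.
have h0 : (0 < h)%N by rewrite -(ltr_nat R); lra.
(* Arc uses are rounded up, so that every cut still carries at least [n * r >= h] packets per
   round. *)
pose c (a : arcs A) := (Num.truncn (n%:R * z a)).+1.
have cz a : n%:R * z a <= (c a)%:R <= n%:R * z a + 1.
  have := truncn_itv (mulr_ge0 (ltW n0) (z0 a)); rewrite -/(c a) => /andP [h1 /ltW ->].
  by rewrite /c -natr1 lerD2r.
pose l := flatten [seq nseq (c a) a | a <- enum {: arcs A}].
have hl (S : {set V}) : s \in S -> ~~ (T \subset S) ->
    (h <= count (leaves (@arc_tail V A) (@arc_head V A) S) l)%N.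
  move=> sS /subsetPn [t tT tS]; rewrite count_sum_count_mem.
  under eq_bigr => a _ do rewrite count_mem_flatten_nseq.
  rewrite -(ler_nat R) natr_sum; apply: le_trans hle _.
  apply: le_trans (ler_wpM2l (ltW n0) (zr t S tT _)) _; first by apply/andP.
  by rewrite mulr_sumr; apply: ler_sum => a _; case/andP: (cz a).
have [|F [code [links dec]]] := exists_linear_code (n := #|V| + m) sT h0 _ hl.
  by rewrite -[X in (X < _)%N]addn0 ltn_add2l.
have t0 : 0 < n%:R * (#|V| + m)%:R :> R by rewrite mulr_gt0 // ltr0n addn_gt0 m0 orbT.
have m1 : 1 <= m%:R :> R by rewrite ler1n.
have V0 : 0 <= #|V|%:R :> R by [].
exists F, (n%:R * (#|V| + m)%:R), _, (fun a => c a * (#|V| + m))%N, code; split=> //.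
- by split=> //; apply: card_finNzRing_gt1.
- apply: distr_div_le => //.
  have : (h * (#|V| + m - #|V|)).-1%:R + 1 = h%:R * m%:R :> R.
    by rewrite natr1 addKn prednK ?muln_gt0 ?h0 // natrM.
  set k := _.-1%:R => kE; have -> : k = h%:R * m%:R - 1 by lra.
  rewrite natrD; set v : R := #|V|%:R in me V0 *; set M : R := m%:R in me m1 *.
  set N : R := n%:R in nr ne n0 hle hgt *; set H : R := h%:R in hle hgt *.
  apply/andP; split; last first.
    have : H * M <= N * r * M by rewrite ler_wpM2r //; lra.
    have : 0 <= N * r * v by rewrite mulr_ge0 //; lra.
    have : 0 <= e * (N * (v + M)) by rewrite !mulr_ge0 //; lra.
    lra.
  (* Half of the slack [e * tau] absorbs the [#|V|] lost rounds, the other half the rounding of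
     [n * r] to [h] and the final [- 1]. *)
  have : (N * r - 1) * M <= H * M by rewrite ler_wpM2r //; lra.
  have : 4 * (v + M) <= N * e * (v + M) by rewrite ler_wpM2r //; lra.
  have : N * (2 * r * v) <= N * (M * e) by rewrite ler_wpM2l //; lra.
  have : 0 <= N * e * v by rewrite !mulr_ge0 //; lra.
  lra.
- move=> a; apply: distr_div_le => //.
  rewrite natrM !mulrA !ler_pM2r ?ltr0n ?addn_gt0 ?m0 ?orbT //.
  by have := cz a => /andP [h1 h2]; apply/andP; split; lra.
- move=> a; rewrite /usage links; elim: (_ + _)%N => [|L IH]; first by rewrite muln0.
  by rewrite mulnS /= count_cat IH count_mem_flatten_nseq.
Qed.

(** * Equivalence of feasible flows and multicast codes *)

Theorem theorem1 (R : realType) (V : finType) (A : {set V * V})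
    (s : V) (T : {set V}) (r : R)
    (Z : set (arc_vector A R)) (f : Z -> R) (z : arc_vector A R) :
  T \subset [set~ s] -> T != finset.set0 -> 0 < r ->
  (forall y, Z y -> forall a, 0 <= y a) ->
  convex_set (M := arc_vector A R) Z ->
  Z 0 ->
  Z z ->
  (exists x : V -> arc_vector A R, feasible Z s T r z x) <->
  multicast_achievable s T r z.
Proof.
move=> Ts _ r0 Z0 _ _ Zz.
have sT : s \notin T by apply/negP => /(fintype.subsetP Ts); rewrite !inE eqxx.
split=> [[x [_ xz xr]] | ach].
  apply: cut_achievable => //; first exact: Z0.
  by move=> t S tT sS; apply: (flow_le_cut sS (xz t tT)) => v; exact: xr.
have flow t : exists x : arc_vector A R, t \in T ->
    (forall a, 0 <= x a <= z a) /\
    forall i, \sum_(a | arc_tail a == i) x a - \sum_(a | arc_head a == i) x a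
          = supply r s t i.
  case: (boolP (t \in T)) => tT; last by exists 0.
  have [|y [yz yr]] := max_flow_min_cut (ltW r0) _ (Z0 z Zz)
    (fun S => achievable_le_cut (S := S) ach tT).
    by apply: contraNneq sT => ->.
  exists [ffun a => y a] => _; split=> [a|i]; first by rewrite ffunE.
  by rewrite /supply -yr; congr (_ - _); apply: eq_bigr => a _; rewrite ffunE.
have [x hx] := choice flow.
by exists x; split=> // t /hx [].
Qed.
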